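(* Every $d$-dimensional extremal $(0,1)$-matrix of order $n$ with deficiency $1$ or $\tfrac12$ is diagonally extremal.
   Context: A $d$-dimensional matrix of order $n$ is an array $(a_\alpha)_{\alpha\in\{1,\dots,n\}^d}$; $\mathrm{supp}(A)=\{\alpha:a_\alpha\ne0\}$; the hyperplane $\Gamma_{i,j}$ is the set of indices with $\alpha_i=j$. For an index $\alpha$, $A_\alpha$ is the submatrix of order $n-1$ obtained from $A$ by deleting all hyperplanes containing $\alpha$. A polyplex of weight $W$ is a nonnegative matrix $K$ whose entries sum to at most $1$ over each hyperplane and to $W$ in total; a polydiagonal in a matrix of order $m$ is a polyplex of weight $m$; a diagonal is a $(0,1)$-matrix with exactly one unit entry in each hyperplane. A $(0,1)$-matrix $A$ contains $K$ if $\mathrm{supp}(K)\subseteq\mathrm{supp}(A)$. A $(0,1)$-matrix $A$ is extremal if it contains no polydiagonal, but for every $\alpha$ with $a_\alpha=0$ the matrix obtained by changing $a_\alpha$ to $1$ contains a polydiagonal; it is diagonally extremal if it contains no polydiagonal and for every $\alpha$ with $a_\alpha=0$ the submatrix $A_\alpha$ contains a diagonal. The deficiency of an extremal matrix of order $n$ is $n$ minus the maximum weight of a polyplex it contains. *)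

(* Defs.v *)
From HB Require Import structures.
From mathcomp Require Import all_boot all_order all_algebra.
From mathcomp Require Import reals.

Set Implicit Arguments.
Unset Strict Implicit.
Unset Printing Implicit Defensive.

Import Order.TTheory GRing.Theory Num.Theory.
Local Open Scope ring_scope.

Definition mdindex (d n : nat) := {ffun 'I_d -> 'I_n}.

(* d-dimensional matrices of order n; (0,1)-matrices are [mdmatrix bool d n],
   with unit entry [true]. *)
Definition mdmatrix (T : Type) (d n : nat) := {ffun mdindex d n -> T}.

Definition hyperplane (d n : nat) (i : 'I_d) (j : 'I_n) : {set mdindex d n} :=
  [set a : mdindex d n | a i == j].

(* On [bool] the zero of the (field) structure is [false]; see [supp_bool]. *)
Definition supp (V : nmodType) (d n : nat) (A : mdmatrix V d n) :
    {set mdindex d n} :=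
  [set a | A a != 0].

Lemma supp_bool (d n : nat) (A : mdmatrix bool d n) : supp A = [set a | A a].
Proof. by apply/setP=> a; rewrite !inE; case: (A a). Qed.

Definition contains (V : nmodType) (d n : nat)
    (A : mdmatrix bool d n) (K : mdmatrix V d n) : bool :=
  supp K \subset supp A.

Definition polyplex (R : realType) (d n : nat) (K : mdmatrix R d n) (W : R) :
    Prop :=
  [/\ forall a, 0 <= K a,
      forall (i : 'I_d) (j : 'I_n), \sum_(a in hyperplane i j) K a <= 1
    & \sum_a K a = W].

Definition polydiagonal (R : realType) (d n : nat) (K : mdmatrix R d n) :
    Prop :=
  polyplex K n%:R.

Definition diagonal (d n : nat) (D : mdmatrix bool d n) : Prop :=
  forall (i : 'I_d) (j : 'I_n), #|hyperplane i j :&: supp D| = 1%N.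

Definition contains_polydiagonal (R : realType) (d n : nat)
    (A : mdmatrix bool d n) : Prop :=
  exists2 K : mdmatrix R d n, polydiagonal K & contains A K.

Definition contains_diagonal (d n : nat) (A : mdmatrix bool d n) : Prop :=
  exists2 D : mdmatrix bool d n, diagonal D & contains A D.

Definition set_unit (d n : nat) (A : mdmatrix bool d n) (a : mdindex d n) :
    mdmatrix bool d n :=
  [ffun b => if b == a then true else A b].

(* [lift (a i)] enumerates increasingly the elements of 'I_n other than [a i],
   so this deletes every hyperplane containing [a]. *)
Definition del_index (d n : nat) (A : mdmatrix bool d n) (a : mdindex d n) :
    mdmatrix bool d n.-1 :=
  [ffun b : mdindex d n.-1 => A [ffun i => lift (a i) (b i)]].

Definition extremal (R : realType) (d n : nat) (A : mdmatrix bool d n) : Prop :=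
  ~ contains_polydiagonal R A /\
  (forall a, A a = false -> contains_polydiagonal R (set_unit A a)).

Definition diagonally_extremal (R : realType) (d n : nat)
    (A : mdmatrix bool d n) : Prop :=
  ~ contains_polydiagonal R A /\
  (forall a, A a = false -> contains_diagonal (del_index A a)).

Definition contains_polyplex_of_weight (R : realType) (d n : nat)
    (A : mdmatrix bool d n) (W : R) : Prop :=
  exists2 K : mdmatrix R d n, polyplex K W & contains A K.

Definition max_polyplex_weight (R : realType) (d n : nat)
    (A : mdmatrix bool d n) (W : R) : Prop :=
  contains_polyplex_of_weight A W /\
  (forall W' : R, contains_polyplex_of_weight A W' -> W' <= W).

Definition deficiency_eq (R : realType) (d n : nat) (A : mdmatrix bool d n)
    (delta : R) : Prop :=
  exists2 W : R, max_polyplex_weight A W & delta = n%:R - W.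

(* Main.v *)
(* By linear programming duality (Farkas' lemma), [A] has a fractional cover
   [l] by hyperplanes of weight [n - delta], and extremality forces every
   zero [a] of [A] to satisfy [sum_i l_i(a_i) <= 1 - delta <= 1/2].  Each [l_i]
   vanishes somewhere, since otherwise subtracting minima and rescaling gives a
   cheaper cover; hence partial sums of [l_i(a_i)] are again at most 1/2 or at
   least 1, and [l] can be rounded down to a cover with values in {0, 1/2, 1}.
   Let [w] be its double.  Minimality of the cover prevents one direction from
   having more than half of the ones of [w].  After discarding at most one of
   them, the remaining ones can be paired across distinct directions;
   the pairs and the twos then form the rows of a diagonal avoiding the
   hyperplanes of a given zero of [A]. *)
Require Import Defs.
From HB Require Import structures.
From mathcomp Require Import all_boot all_order all_algebra.
From mathcomp Require Import perm reals boolp.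
From mathcomp Require Import ring lra zify.

Set Implicit Arguments.
Unset Strict Implicit.
Unset Printing Implicit Defensive.

Import Order.TTheory GRing.Theory Num.Theory.
Local Open Scope ring_scope.

(** * Farkas' lemma and linear programming duality for covers *)

(* Bartl's induction on the number of constraints: if dropping [a i0] makes the
   implication fail at [x], project along [x] onto the kernel of [a i0]. *)
Lemma farkas_seq (R : realFieldType) (I T : finType) (s : seq I)
    (a : I -> T -> R) (b : T -> R) :
  uniq s ->
  (forall x : T -> R, (forall i, i \in s -> \sum_t a i t * x t <= 0) ->
     \sum_t b t * x t <= 0) ->
  exists2 l : I -> R, forall i, 0 <= l i
    & forall t, b t = \sum_(i <- s) l i * a i t.
Proof.
elim: s a b => [|i0 s IHs] a b /=.
  move=> _ bneg; exists (fun=> 0) => // t; rewrite big_nil; apply/eqP.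
  have : \sum_u b u * b u == 0.
    by rewrite eq_le bneg//= sumr_ge0// => u _; rewrite -expr2 sqr_ge0.
  rewrite psumr_eq0 => [|u _]; last by rewrite -expr2 sqr_ge0.
  by move/allP/(_ t (mem_index_enum t)); rewrite mulf_eq0 orbb.
case/andP=> i0s us hb.
have [hs|] := pselect (forall x : T -> R,
    (forall i, i \in s -> \sum_t a i t * x t <= 0) -> \sum_t b t * x t <= 0).
  have [l l0 lb] := IHs a b us hs.
  exists (fun i => if i == i0 then 0 else l i) => [i|t].
    by case: ifP.
  rewrite big_cons eqxx mul0r add0r lb; apply: eq_big_seq => i si.
  by case: eqP si i0s => // -> ->.
move=> /existsNP[x /not_implyP[xs /negP]]; rewrite -ltNge => bx.
have ax : 0 < \sum_t a i0 t * x t.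
  rewrite ltNge; apply/negP => ax; move: bx; rewrite ltNge; case/negP.
  by apply: hb => i; rewrite inE => /predU1P[->|/xs].
pose al := \sum_t a i0 t * x t.
(* With these coefficients [a i - p i * a i0] and [b - q * a i0] vanish at [x]; by [shift], their
   values at [y] are those of [a i] and [b] at the projection of [y] along [x]. *)
pose p i := (\sum_t a i t * x t) / al.
pose q := (\sum_t b t * x t) / al.
have comb (c : T -> R) k (y : T -> R) :
    \sum_t (c t - k * a i0 t) * y t =
    \sum_t c t * y t - k * \sum_t a i0 t * y t.
  by rewrite mulr_sumr -sumrB; apply: eq_bigr => t _; ring.
have shift (c : T -> R) (y : T -> R) (z := \sum_t a i0 t * y t) :
    \sum_t c t * (y t - z / al * x t) =
    \sum_t (c t - (\sum_t c t * x t) / al * a i0 t) * y t.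
  rewrite comb -/z; under eq_bigr do rewrite mulrBr mulrCA.
  by rewrite sumrB -mulr_sumr; congr (_ - _); ring.
have [|l l0 lb] := IHs (fun i t => a i t - p i * a i0 t)
    (fun t => b t - q * a i0 t) us.
  move=> y hy; rewrite -shift; apply: hb => i.
  rewrite inE => /predU1P[->|si]; last by rewrite shift; apply: hy.
  by rewrite shift divff ?gt_eqF// big1// => t _; ring.
(* The multiplier of [a i0] collects all the corrections; it is nonnegative because [q > 0] and
   [p j <= 0] on [s]. *)
exists (fun i => if i == i0 then q - \sum_(j <- s) l j * p j else l i).
  move=> i; case: ifP => // _; rewrite subr_ge0.
  apply: (@le_trans _ _ 0); last by rewrite divr_ge0 ?ltW.
  rewrite big_seq sumr_le0// => j js; rewrite mulr_ge0_le0//.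
  by rewrite mulr_le0_ge0 ?xs// invr_ge0 ltW.
move=> t; rewrite big_cons eqxx.
have -> : b t = q * a i0 t + (b t - q * a i0 t) by ring.
rewrite lb mulrBl -addrA; congr (_ + _).
rewrite mulr_suml -sumrN -[RHS]big_split /= !big_seq; apply: eq_bigr => i si.
by case: eqP si i0s => [->->//|_ _ _]; ring.
Qed.

Lemma weak_duality (R : realType) (d n : nat) (l : 'I_d -> 'I_n -> R)
    (K : mdmatrix R d n) (W : R) :
  (forall i j, 0 <= l i j) -> polyplex K W ->
  \sum_a K a * \sum_i l i (a i) <= \sum_i \sum_j l i j.
Proof.
move=> l0 [K0 K1 _].
under eq_bigr do rewrite mulr_sumr.
rewrite exchange_big /=; apply: ler_sum => i _.
rewrite (partition_big (fun a : mdindex d n => a i) predT) //=.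
apply: ler_sum => j _.
rewrite (eq_bigr (fun a => K a * l i j)) => [|a /eqP->//].
rewrite -mulr_suml ler_piMl//.
by rewrite (eq_bigl [in hyperplane i j]) // => a; rewrite inE.
Qed.

Definition cover (R : realType) (d n : nat) (A : mdmatrix bool d n)
    (l : 'I_d -> 'I_n -> R) : Prop :=
  (forall i j, 0 <= l i j) /\ (forall a, A a -> 1 <= \sum_i l i (a i)).

Lemma sum_indicator (R : pzRingType) (I : finType) (P : pred I) (x : I -> R) :
  \sum_i (P i)%:R * x i = \sum_(i | P i) x i.
Proof.
by rewrite [RHS]big_mkcond; apply: eq_bigr => i _; case: (P i); rewrite ?mul1r ?mul0r.
Qed.

Lemma sum_indicator1 (R : pzRingType) (I : finType) (k : I) (x : I -> R) :
  \sum_i (i == k)%:R * x i = x k.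
Proof. by rewrite sum_indicator big_pred1_eq. Qed.

(* Farkas' lemma is applied to the homogenized program in the variables
   (x_a)_a and t, the latter being carried by the summand 'I_1. *)
Lemma strong_duality (R : realType) (d n : nat) (hd : (0 < d)%N)
    (A : mdmatrix bool d n) (W : R) :
  (forall W', contains_polyplex_of_weight A W' -> W' <= W) ->
  exists2 l, cover A l & \sum_i \sum_j l i j <= W.
Proof.
move=> maxW.
pose T := (mdindex d n + 'I_1)%type.
(* Constraint [inl (i, j)] bounds a hyperplane sum by t, constraint [inr t'] is the nonnegativity of
   the variable [t'], and [b] is the sum of x over the ones of [A] minus W t. *)
pose f (i : ('I_d * 'I_n) + T) (t : T) : R :=
  match i, t with
  | inl ij, inl a => (a ij.1 == ij.2)%:R
  | inl _, inr _ => -1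
  | inr t', _ => - (t == t')%:R
  end.
pose b (t : T) : R := match t with inl a => (A a)%:R | inr _ => - W end.
have [x fx|l l0 lb] := @farkas_seq R _ T (enum predT) f b (enum_uniq _).
  have {}fx i : \sum_t f i t * x t <= 0 by apply: fx; rewrite mem_enum.
  have x0 t : 0 <= x t.
    have := fx (inr t); rewrite /f.
    under eq_bigr do rewrite mulNr.
    by rewrite sumrN oppr_le0 sum_indicator1.
  have xh i j : \sum_(a in hyperplane i j) x (inl a) <= x (inr ord0).
    have := fx (inl (i, j)); rewrite big_sumType big_ord1 /= mulN1r subr_le0.
    rewrite sum_indicator; apply: le_trans.
    by rewrite le_eqVlt; apply/orP; left; apply/eqP; apply: eq_bigl => a; rewrite inE.
  rewrite big_sumType big_ord1 /= mulNr subr_le0 sum_indicator.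
  (* If t = 0, the hyperplane bounds kill every x_a; otherwise x / t, restricted to the ones of [A],
     is a polyplex. *)
  have [t0|t0] := eqVneq (x (inr ord0)) 0.
    rewrite t0 mulr0 sumr_le0// => a _; rewrite -t0.
    apply: le_trans (xh (Ordinal hd) (a (Ordinal hd))).
    rewrite (bigD1 a) ?inE//= lerDl sumr_ge0// => c _; exact: x0.
  have {t0}tp : 0 < x (inr ord0) by rewrite lt_def t0 x0.
  rewrite -ler_pdivrMr//; apply: maxW.
  exists [ffun a => (A a)%:R * x (inl a) / x (inr ord0)]; last first.
    apply/subsetP => a; rewrite supp_bool !inE ffunE.
    by case: (A a) => //; rewrite !mul0r eqxx.
  split.
  - by move=> a; rewrite ffunE divr_ge0 ?mulr_ge0 ?ler0n.
  - move=> i j; under eq_bigr do rewrite ffunE.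
    rewrite -mulr_suml ler_pdivrMr// mul1r; apply: le_trans (xh i j).
    by apply: ler_sum => a _; case: (A a); rewrite ?mul1r ?mul0r.
  - under eq_bigr do rewrite ffunE.
    by rewrite -mulr_suml sum_indicator.
(* The multipliers of the sign constraints enter negatively, so dropping them turns the identity
   [lb] into the covering and weight inequalities. *)
exists (fun i j => l (inl (i, j))); first split=> // a Aa.
  have -> : 1 = b (inl a) by rewrite /b Aa.
  rewrite lb big_enum/= big_sumType/=.
  rewrite -[leRHS]addr0 lerD//.
    rewrite (eq_bigr (fun p : 'I_d * 'I_n => l (inl (p.1, p.2)) * (a p.1 == p.2)%:R)); last by case.
    rewrite -(pair_bigA _ (fun i j => l (inl (i, j)) * (a i == j)%:R)) /=.
    apply: ler_sum => i _; under eq_bigr do rewrite mulrC eq_sym.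
    by rewrite sum_indicator1.
  by rewrite sumr_le0// => t _; rewrite mulrN oppr_le0 mulr_ge0 ?ler0n.
have := lb (inr ord0); rewrite big_enum/= big_sumType/= => /eqP.
rewrite pair_bigA /= eqr_oppLR => /eqP ->.
rewrite opprD -[leLHS]addr0 lerD//.
  rewrite -sumrN; apply: ler_sum => -[i j] _ /=; by rewrite mulrN1 opprK.
by rewrite oppr_ge0 sumr_le0// => t _; rewrite mulrN oppr_le0 mulr_ge0 ?ler0n.
Qed.

(** * Covers of optimal weight *)

Lemma cover_weight_ge (R : realType) (d n : nat) (A : mdmatrix bool d n)
    (l : 'I_d -> 'I_n -> R) (W : R) :
  cover A l -> contains_polyplex_of_weight A W -> W <= \sum_i \sum_j l i j.
Proof.
move=> [l0 lA] [K KW AK]; apply: le_trans (weak_duality l0 KW).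
case: KW => K0 _ <-; apply: ler_sum => a _.
have [->|Ka] := eqVneq (K a) 0; first by rewrite mul0r.
rewrite ler_peMr//; apply: lA.
by move/subsetP/(_ a): AK; rewrite supp_bool !inE; apply.
Qed.

(** Let s be the sum of [l] at [a], and pair [l] with a polydiagonal K of the enlarged matrix. Only
    [a] can be undercovered, so n - K_a (1 - s) is at most the weight of [l], hence at most n - del.
    Thus del <= K_a (1 - s), and K_a <= 1 concludes. *)
Lemma cover_zero_le (R : realType) (d n : nat) (hd : (0 < d)%N)
    (A : mdmatrix bool d n) (l : 'I_d -> 'I_n -> R) (del : R) a :
  cover A l -> 0 < del -> \sum_i \sum_j l i j <= n%:R - del ->
  contains_polydiagonal R (set_unit A a) -> \sum_i l i (a i) <= 1 - del.
Proof.
move=> [l0 lA] del0 lW [K KW AK].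
have := weak_duality l0 KW.
case: KW => K0 K1 /(congr1 (fun x => x + K a * (\sum_i l i (a i) - 1))) Kn Kl.
have Ka1 : K a <= 1.
  apply: le_trans (K1 (Ordinal hd) (a (Ordinal hd))).
  by rewrite (bigD1 a) ?inE//= lerDl sumr_ge0.
have : \sum_b K b + K a * (\sum_i l i (a i) - 1) <=
       \sum_b K b * \sum_i l i (b i).
  rewrite (bigD1 a)//= [leRHS](bigD1 a)//= mulrBr mulr1.
  rewrite addrAC addrCA subrr addr0 lerD2l.
  apply: ler_sum => b ba.
  have [->|Kb] := eqVneq (K b) 0; first by rewrite mul0r.
  rewrite ler_peMr//; apply: lA.
  move/subsetP/(_ b): AK; rewrite supp_bool !inE => /(_ Kb).
  by rewrite ffunE (negPf ba).
rewrite Kn => le1.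
have {le1 Kl lW} : del <= K a * (1 - \sum_i l i (a i)).
  by rewrite -opprB mulrN; lra.
have := K0 a; move: (\sum_i l i (a i)) (K a) Ka1 {Kn} => s k k1 k0 dk.
have [s1|s1] := lerP s 1; last nra.
have : k * (1 - s) <= 1 - s by rewrite ler_piMl// subr_ge0.
lra.
Qed.

Lemma optimal_cover_row_min0 (R : realType) (d n : nat) (hn : (0 < n)%N)
    (A : mdmatrix bool d n) (l : 'I_d -> 'I_n -> R) (del : R) :
  cover A l -> 0 < del -> \sum_i \sum_j l i j <= n%:R - del ->
  (forall m, cover A m -> n%:R - del <= \sum_i \sum_j m i j) ->
  exists z : mdindex d n, forall i, l i (z i) = 0.
Proof.
move=> [l0 lA] del0 lW hge.
pose z := [ffun i => Order.arg_min (Ordinal hn) xpredT (l i)] : mdindex d n.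
have zmin i j : l i (z i) <= l i j.
  by rewrite ffunE; case: (@arg_minP _ _ _ (Ordinal hn) xpredT (l i)) => // k _; apply.
pose s := \sum_i l i (z i).
have sum_sub : \sum_i \sum_j (l i j - l i (z i)) = \sum_i \sum_j l i j - n%:R * s.
  rewrite mulr_sumr -sumrB; apply: eq_bigr => i _.
  by rewrite sumrB sumr_const card_ord mulr_natl.
have s0 : 0 <= s by apply: sumr_ge0.
have n0 : 0 < n%:R :> R by rewrite ltr0n.
have s1 : s < 1.
  have : 0 <= \sum_i \sum_j (l i j - l i (z i)).
    by apply: sumr_ge0 => i _; apply: sumr_ge0 => j _; rewrite subr_ge0.
  by rewrite sum_sub => ?; nra.
(* Subtracting the minima and rescaling by [1 - s] gives a cover that would be
   cheaper than the optimum unless [s = 0]. *)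
have /hge : cover A (fun i j => (l i j - l i (z i)) / (1 - s)).
  split=> [i j|a Aa]; first by rewrite divr_ge0// ?subr_ge0// ltW.
  by rewrite -mulr_suml sumrB ler_pdivlMr ?subr_gt0// mul1r lerD2r lA.
under eq_bigr do rewrite -mulr_suml.
rewrite -mulr_suml sum_sub ler_pdivlMr ?subr_gt0// => le_s.
(* Together with [lW], the inequality [le_s] amounts to [del * s <= 0]. *)
have s00 : s = 0.
  apply/eqP; rewrite eq_le s0 andbT leNgt; apply/negP => sp.
  by have := mulr_gt0 del0 sp; nra.
exists z => i; apply/eqP.
move/eqP: s00; rewrite psumr_eq0 => [|k _]; last exact: l0.
by move/allP/(_ i (mem_index_enum i)).
Qed.

(** * Rounding to a half-integral cover *)

Lemma half_integral_cover (R : realType) (d n : nat) (A : mdmatrix bool d n)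
    (l : 'I_d -> 'I_n -> R) (z : mdindex d n) :
  cover A l -> (forall i, l i (z i) = 0) ->
  (forall a, A a = false -> \sum_i l i (a i) <= 2^-1) ->
  exists w : 'I_d -> 'I_n -> nat,
    [/\ forall i j, (w i j <= 2)%N,
        forall a, A a -> (2 <= \sum_i w i (a i))%N
      & forall i j, (w i j)%:R <= 2 * l i j].
Proof.
move=> [l0 lA] lz lA0.
(* Twice the largest of 0, 1/2, 1 that does not exceed [l i j]. *)
pose w i j : nat := ((2^-1 <= l i j)%R + (1 <= l i j)%R)%N.
exists w; split.
- by move=> i j; rewrite /w; case: (_ <= _); case: (_ <= _).
- move=> a Aa.
  (* Filling the coordinates outside [S] from [z] makes the partial sum over [S] a full sum at an
     index of [A]: at least 1 at a one, at most 1/2 at a zero. *)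
  pose mix (S : {set 'I_d}) : mdindex d n :=
    [ffun i => if i \in S then a i else z i].
  have mixE S : \sum_i l i (mix S i) = \sum_(i in S) l i (a i).
    rewrite [RHS]big_mkcond; apply: eq_bigr => i _.
    by rewrite ffunE; case: ifP.
  pose P (S : {set 'I_d}) := 1 <= \sum_(i in S) l i (a i).
  have gap S : ~~ P S -> \sum_(i in S) l i (a i) <= 2^-1.
    rewrite -mixE => PS; apply: lA0; apply: contraNF PS => /lA.
    by rewrite mixE.
  (* Removing an index from a minimal [S] with sum at least 1 drops the sum
     below 1, hence to at most 1/2. *)
  have [|S /minsetP[PS Smin]] := @ex_minset _ P.
    by exists setT; rewrite /P; under eq_bigl do rewrite inE; exact: lA.
  have half i : i \in S -> 2^-1 <= l i (a i).
    move=> iS; have : ~~ P (S :\ i).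
      apply/negP => /Smin /(_ (subsetDl _ _)) /setP /(_ i).
      by rewrite !inE eqxx iS.
    by move/gap; move: PS; rewrite /P (big_setD1 i iS) /=; lra.
  have wS : (\sum_(i in S) w i (a i) <= \sum_i w i (a i))%N.
    by rewrite big_mkcond; apply: leq_sum => i _; case: ifP.
  apply: leq_trans wS.
  have [S2|] := ltnP 1 #|S|.
    rewrite (leq_trans S2)// -sum1_card; apply: leq_sum => i iS.
    by rewrite /w half.
  rewrite leq_eqVlt ltnS leqn0 => /orP[/cards1P[i Si]|/eqP/cards0_eq S0].
    move: PS; rewrite /P Si !big_set1 /w => l1.
    by rewrite l1 (le_trans _ l1)//; lra.
  by exfalso; move: PS; rewrite /P S0 big_set0 ler10.
- move=> i j; rewrite /w; have := l0 i j.
  by case: (lerP 2^-1 (l i j)); case: (lerP 1 (l i j)) => /=; lra.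
Qed.

Local Open Scope nat_scope.

(** * Distributing twos and pairs of ones into rows *)

Lemma sum_nat_pred1 (I : finType) (k : I) : \sum_i (i == k) = 1.
Proof. by rewrite (bigD1 k)//= eqxx big1// => i /negPf ->. Qed.

(** [c i] and [h i] count the twos and ones of direction [i]. Each two forms a row by itself; then
    ones are paired greedily, always from the two directions with the most ones left, which
    preserves the balance condition. *)
Lemma exists_rows (d m : nat) (c h : 'I_d -> nat) :
  2 * \sum_i c i + \sum_i h i = 2 * m ->
  (forall k, 2 * h k <= \sum_i h i) ->
  exists T : seq {ffun 'I_d -> nat},
    [/\ size T = m,
        forall r, r \in T -> 2 <= \sum_i r i,
        forall r i, r \in T -> r i <= 2,
        forall i, count (fun r : {ffun 'I_d -> nat} => r i == 2) T = c i
      & forall i, count (fun r : {ffun 'I_d -> nat} => r i == 1) T = h i].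
Proof.
elim: m c h => [|m IHm] c h.
  rewrite muln0 => /eqP; rewrite addn_eq0 muln_eq0 /= !sum_nat_eq0.
  move=> /andP[/forallP c0 /forallP h0] _; exists [::]; split=> // i /=.
    by have /eqP := c0 i.
  by have /eqP := h0 i.
move=> sumE hle.
have [/existsP[i ci]|] := boolP [exists i, 0 < c i].
  pose c' k := c k - (k == i).
  have c'E k : c k = (k == i) + c' k by rewrite /c'; case: eqP => [->|_]; lia.
  have sc : \sum_k c k = 1 + \sum_k c' k.
    rewrite (eq_bigr _ (fun k _ => c'E k)) big_split /=; congr (_ + _).
    exact: sum_nat_pred1.
  have [|T [sT T2 Tle Tc Th]] := IHm c' h _ hle; first by move: sumE; rewrite sc; lia.
  exists ([ffun k => 2 * (k == i)] :: T); split=> /=.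
  - by rewrite sT.
  - move=> r; rewrite inE => /predU1P[->|/T2//].
    by rewrite (bigD1 i)//= ffunE eqxx leq_addr.
  - move=> r k; rewrite inE => /predU1P[->|/Tle//].
    by rewrite ffunE; case: (k == i).
  - by move=> k; rewrite ffunE Tc c'E; case: (k == i).
  - by move=> k; rewrite ffunE Th; case: (k == i).
rewrite negb_exists => /forallP c0.
have {}c0 k : c k = 0 by have := c0 k; lia.
have {}sumE : \sum_i h i = 2 * m.+1 by move: sumE; rewrite (eq_bigr _ (fun k _ => c0 k)) big1.
have /existsP[k0 hk0] : [exists k, 0 < h k].
  rewrite -[[exists _, _]]negbK negb_exists; apply/negP => /forallP h0.
  by move: sumE; rewrite big1// => i _; have := h0 i; lia.
have [k _ kmax] := @arg_maxnP _ k0 xpredT h isT.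
have /existsP[l0 /andP[l0k hl0]] : [exists l, (l != k) && (0 < h l)].
  rewrite -[[exists _, _]]negbK negb_exists; apply/negP => /forallP h0.
  have := hle k; rewrite (bigD1 k)//= big1 => [|i ik]; last by have := h0 i; rewrite ik; lia.
  by have := kmax k0 isT; lia.
have [l lk lmax] := @arg_maxnP _ l0 (fun l => l != k) h l0k.
pose row i : nat := (i == k) || (i == l).
pose h' i := h i - row i.
have hl : 0 < h l by have := lmax _ l0k; lia.
have hk : 0 < h k by have := kmax k0 isT; lia.
have h'E i : h i = row i + h' i.
  by rewrite /h' /row; case: (i =P k) => [->|_]; case: (_ =P l) => [->|_] /=; lia.
have srow : \sum_i row i = 2.
  rewrite (bigD1 k)//= (bigD1 l)//= big1 /row ?eqxx ?orbT// => i /andP[ik il].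
  by rewrite (negPf ik) (negPf il).
have sh' : \sum_i h' i = 2 * m.
  by move: sumE; rewrite (eq_bigr _ (fun k _ => h'E k)) big_split /= srow; lia.
have [||T [sT T2 Tle Tc Th]] := IHm c h'.
- by rewrite (eq_bigr _ (fun k _ => c0 k)) big1.
- move=> p; rewrite sh'.
  (* A chosen direction loses a one. Any other [p] satisfies [h p <= h l <= h k], so
     [3 * h p <= 2 * m.+1] and therefore [h p <= m]. *)
  have [rp|] := boolP ((p == k) || (p == l)).
    by have := hle p; rewrite sumE /h' /row rp; lia.
  rewrite negb_or => /andP[pk pl].
  have : h k + h l + h p <= \sum_i h i.
    rewrite (bigD1 k)//= (bigD1 l)//= (bigD1 p) /=; last by rewrite pk pl.
    by rewrite !addnA leq_addr.
  have := lmax p pk; have := kmax l isT.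
  by rewrite sumE /h' /row; lia.
exists (finfun row :: T); split=> /=.
- by rewrite sT.
- move=> r; rewrite inE => /predU1P[->|/T2//].
  by under eq_bigr do rewrite ffunE; rewrite srow.
- move=> r i; rewrite inE => /predU1P[->|/Tle//].
  by rewrite ffunE /row; case: (_ || _).
- by move=> i; rewrite ffunE Tc /row; case: (_ || _).
- by move=> i; rewrite ffunE Th h'E /row; case: (_ || _).
Qed.

Lemma perm_eq_le2 (s t : seq nat) :
  size s = size t -> all (leq^~ 2) s -> all (leq^~ 2) t ->
  count_mem 2 s = count_mem 2 t -> count_mem 1 s = count_mem 1 t ->
  perm_eq s t.
Proof.
move=> st s2 t2 c2 c1.
have sizeE (u : seq nat) : all (leq^~ 2) u ->
    size u = count_mem 0 u + count_mem 1 u + count_mem 2 u.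
  by elim: u => //= x u IHu /andP[x2 /IHu ->]; case: x x2 => [|[|[|]]]//= _; lia.
have := sizeE _ s2; rewrite st (sizeE _ t2) c2 c1 => /addIn /addIn c0.
apply/allP => x; rewrite mem_cat => /orP[/(allP s2)|/(allP t2)];
  by case: x => [|[|[|]]]//= _; apply/eqP.
Qed.

Definition ones (d m : nat) (w : 'I_d -> 'I_m -> nat) (i : 'I_d) : nat :=
  \sum_j (w i j == 1).

Lemma sum_ones_twos (d m : nat) (w : 'I_d -> 'I_m -> nat) :
  (forall i j, w i j <= 2) ->
  \sum_i \sum_j w i j =
  2 * (\sum_i \sum_j (w i j == 2)) + \sum_i ones w i.
Proof.
move=> w2; rewrite big_distrr -big_split /=; apply: eq_bigr => i _.
rewrite big_distrr -big_split /=; apply: eq_bigr => j _.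
by have := w2 i j; case: (w i j) => [|[|[|]]].
Qed.

(** In direction [i] the entries of the rows have the same multiplicities as the values of [w i], so
    a permutation [s i] matches them. *)
Lemma exists_perms (d m : nat) (w : 'I_d -> 'I_m -> nat) :
  (forall i j, w i j <= 2) -> \sum_i \sum_j w i j = 2 * m ->
  (forall k, 2 * ones w k <= \sum_i ones w i) ->
  exists s : 'I_d -> {perm 'I_m}, forall r, 2 <= \sum_i w i (s i r).
Proof.
move=> w2 sw ow; rewrite sum_ones_twos// in sw.
have [T [sT T2 Tle Tc Th]] := exists_rows sw ow.
have count_w i x : count_mem x [tuple w i j | j < m] = \sum_j (w i j == x).
  by rewrite -sum1_count big_map big_mkcond /= big_enum.
have /fin_all_exists[s sP] i : exists p : {perm 'I_m},
    map (fun r : {ffun 'I_d -> nat} => r i) T =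
    [tuple tnth [tuple w i j | j < m] (p j) | j < m].
  apply/tuple_permP/perm_eq_le2.
  - by rewrite size_map size_tuple.
  - by apply/allP => _ /mapP[r rT ->]; apply: Tle.
  - by apply/allP => _ /mapP[j _ ->]; apply: w2.
  - by rewrite count_w count_map -Tc.
  - by rewrite count_w count_map -[RHS]Th.
exists s => r.
pose t := nth [ffun=> 0] T r.
have tT : t \in T by rewrite mem_nth// sT.
apply: leq_trans (T2 t tT) _; apply: leq_sum => i _.
have /(congr1 (fun u => nth 0 u r)) := sP i.
rewrite (nth_map [ffun=> 0]) ?sT// -/t => ->.
by rewrite -tnth_nth !tnth_mktuple.
Qed.

(** For [e = 2], [w] already vanishes at [a] and has the right weight. For [e = 1] one unit is in
    excess, and a single one is erased. *)
Lemma exists_drop_half (d n e : nat) (w : 'I_d -> 'I_n -> nat) (a : mdindex d n) :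
  0 < n -> 0 < e <= 2 -> (forall i j, w i j <= 2) ->
  \sum_i \sum_j w i j + e = 2 * n -> \sum_i w i (a i) + e <= 2 ->
  (forall k, 2 * ones w k <= \sum_i ones w i) ->
  exists v : 'I_d -> 'I_n -> nat,
    [/\ forall i j, v i j <= w i j, \sum_i \sum_j v i j = 2 * n.-1,
        forall i, v i (a i) = 0
      & forall k, 2 * ones v k <= \sum_i ones v i].
Proof.
move=> n0 e2 w2 sw wa ow.
have wa_le i : w i (a i) + e <= 2.
  by apply: leq_trans wa; rewrite leq_add2r (bigD1 i)//= leq_addr.
have [E|E] : e = 2 \/ e = 1 by lia.
  by exists w; split=> // [|i]; [lia | have := wa_le i; lia].
subst e.
have odd_ones : \sum_i ones w i = 2 * (n - 1 - \sum_i \sum_j (w i j == 2)) + 1.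
  by move: sw; rewrite sum_ones_twos//; lia.
(* The one to erase is the one met by [a], of which there is at most one by [wa]; if there is none,
   any one will do, and oddness provides it. *)
have [i0 [j0 [w1 wa0]]] : exists i0 j0, w i0 j0 = 1 /\
    forall i, w i (a i) = (i == i0) && (a i == j0).
  have [/existsP[i0 wi0]|] := boolP [exists i, w i (a i) != 0].
    have wi01 : w i0 (a i0) = 1 by have := wa_le i0; move: wi0; lia.
    exists i0, (a i0); split=> // i; case: eqP => [->|/eqP ii0]; first by rewrite eqxx.
    by move: wa; rewrite (bigD1 i0)//= (bigD1 i)//= wi01; lia.
  rewrite negb_exists => /forallP wa0.
  have /existsP[i0 /existsP[j0 /eqP w1]] : [exists i, exists j, w i j == 1].
    rewrite -[[exists _, _]]negbK negb_exists; apply/negP => /forallP h0.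
    move: odd_ones; rewrite big1 ?addn1// => i _; apply: big1 => j _.
    by have := h0 i; rewrite negb_exists => /forallP/(_ j)/negPf ->.
  exists i0, j0; split=> // i; have := wa0 i; rewrite negbK => /eqP wai.
  rewrite wai; case: eqP => // ii0; case: eqP => // aj.
  by move: wai; rewrite aj ii0 w1.
pose at0 i j : nat := (i == i0) && (j == j0).
have sum_at0 i : \sum_j at0 i j = (i == i0).
  rewrite /at0; case: eqP => _ /=; last exact: big1.
  exact: sum_nat_pred1.
pose v i j := w i j - at0 i j.
have vE i j : w i j = at0 i j + v i j.
  by rewrite /v /at0; case: (i =P i0) => [->|_]; case: (j =P j0) => [->|_] /=; rewrite ?w1; lia.
have onesE i : ones w i = (i == i0) + ones v i.
  rewrite -sum_at0 -big_split /=; apply: eq_bigr => j _.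
  rewrite /v /at0; case: (i =P i0) => [->|_]; case: (j =P j0) => [->|_] /=;
    by rewrite ?w1 ?subn0.
have sum_i0 : \sum_i (i == i0) = 1 := sum_nat_pred1 i0.
have sum_ones : \sum_i ones w i = 1 + \sum_i ones v i.
  by rewrite (eq_bigr _ (fun i _ => onesE i)) big_split /= sum_i0.
exists v; split=> [i j|||k].
- exact: leq_subr.
- have : \sum_i \sum_j w i j = 1 + \sum_i \sum_j v i j.
    rewrite -sum_i0 -big_split /=; apply: eq_bigr => i _.
    by rewrite -sum_at0 -big_split /=; apply: eq_bigr.
  by lia.
- by move=> i; rewrite /v wa0 subnn.
(* An even number bounded by the odd total of ones stays bounded after the total drops by 1. *)
- by have := ow k; move: odd_ones; rewrite onesE sum_ones; lia.
Qed.

(** * From permutations to a diagonal of the submatrix *)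

Lemma contains_diagonal_perms (d m : nat) (A : mdmatrix bool d m)
    (s : 'I_d -> {perm 'I_m}) :
  (forall r, A [ffun i => s i r]) -> contains_diagonal A.
Proof.
move=> As; pose b r : mdindex d m := [ffun i => s i r].
exists [ffun a => [exists r, a == b r]].
  move=> i j; pose r0 := (s i)^-1%g j.
  have -> : hyperplane i j :&: supp [ffun a => [exists r, a == b r]] = [set b r0].
    apply/setP => a; rewrite supp_bool !inE ffunE; apply/andP/eqP.
      move=> [/eqP aij /existsP[r /eqP ar]].
      by rewrite ar /r0 -aij ar ffunE permK.
    by move=> ->; split; [rewrite ffunE permKV | apply/existsP; exists r0].
  exact: cards1.
apply/subsetP => a; rewrite !supp_bool !inE ffunE => /existsP[r /eqP ->].
exact: As.
Qed.

Lemma sum_lift (d n : nat) (w : 'I_d -> 'I_n -> nat) (a : mdindex d n) :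
  (forall i, w i (a i) = 0) ->
  forall i (f : nat -> nat), f 0 = 0 ->
    \sum_j f (w i j) = \sum_(j < n.-1) f (w i (lift (a i) j)).
Proof. by move=> wa i f f0; rewrite (bigD1_ord (a i))//= wa f0. Qed.

(** Every index of the diagonal built from the rows has [w]-sum at least 2, whereas a zero of [A]
    has [w]-sum at most [2 - e < 2]; so the diagonal lies on ones of [A]. *)
Lemma del_index_contains_diagonal (d n e : nat) (A : mdmatrix bool d n)
    (w : 'I_d -> 'I_n -> nat) (a : mdindex d n) :
  0 < n -> 0 < e <= 2 -> (forall i j, w i j <= 2) ->
  \sum_i \sum_j w i j + e = 2 * n ->
  (forall b, A b = false -> \sum_i w i (b i) + e <= 2) ->
  (forall k, 2 * ones w k <= \sum_i ones w i) ->
  A a = false -> contains_diagonal (del_index A a).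
Proof.
move=> n0 e2 w2 sw wA ow Aa.
have [v [vw sv va ov]] := exists_drop_half n0 e2 w2 sw (wA a Aa) ow.
pose u i j := v i (lift (a i) j).
have ones_u i : ones u i = ones v i.
  by rewrite /ones (sum_lift va i (f := fun x => (x == 1 : nat))).
have [i j||k|s s2] := @exists_perms d n.-1 u.
- exact: leq_trans (vw _ _) (w2 _ _).
- by rewrite -sv; apply: eq_bigr => i _; rewrite (sum_lift va i (f := id)).
- by rewrite ones_u (eq_bigr _ (fun i _ => ones_u i)).
apply: (@contains_diagonal_perms _ _ _ s) => r; rewrite ffunE.
apply: contraT => /negbTE /wA; set t := \sum_i _.
have : 2 <= t.
  apply: leq_trans (s2 r) _; apply: leq_sum => i _.
  by rewrite !ffunE; exact: vw.
by case: e e2 {sw wA} => // e _; lia.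
Qed.

(** * Balance of the ones in a minimal double cover *)

Lemma double_cover_ones (d n : nat) (A : mdmatrix bool d n)
    (w : 'I_d -> 'I_n -> nat) :
  (forall i j, w i j <= 2) -> (forall a, A a -> 2 <= \sum_i w i (a i)) ->
  (forall v : 'I_d -> 'I_n -> nat, (forall a, A a -> 2 <= \sum_i v i (a i)) ->
     \sum_i \sum_j w i j <= \sum_i \sum_j v i j) ->
  forall k, 2 * ones w k <= \sum_i ones w i.
Proof.
move=> w2 wA wmin k.
(* Competitor: round the ones down in direction [k] and up elsewhere. *)
pose v i j := if w i j == 1 then if i == k then 0 else 2 else w i j.
have /wmin : forall a, A a -> 2 <= \sum_i v i (a i).
  (* A positive value outside direction [k] becomes a 2 on its own; failing that, the value in
     direction [k] is already 2 and is kept. *)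
  move=> a /wA; have [/existsP[i /andP[ik wi]] _|] :=
      boolP [exists i, (i != k) && (0 < w i (a i))].
    rewrite (bigD1 i)//=; apply: leq_trans (leq_addr _ _).
    by rewrite /v (negPf ik); case: (w i (a i)) wi => [|[|]].
  rewrite negb_exists => /forallP w0.
  rewrite (bigD1 k)//= big1 => [|i ik]; last first.
    by have := w0 i; rewrite ik /= -eqn0Ngt => /eqP.
  rewrite addn0 => wk; rewrite (bigD1 k)//=; apply: leq_trans (leq_addr _ _).
  by rewrite /v; case: (w k (a k)) wk => [|[|]].
(* Written without subtraction: direction [k] loses [ones w k] and every other direction gains
   [ones w i]. *)
have vE i : \sum_j v i j + (if i == k then 2 * ones w k else 0) =
    \sum_j w i j + ones w i.
  have [->|ik] := eqVneq i k.
    rewrite mul2n -addnn addnA; congr (_ + _).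
    rewrite -big_split /=; apply: eq_bigr => j _.
    by rewrite /v eqxx; case: eqP => [->|_]; rewrite ?addn0.
  rewrite addn0 -big_split /=; apply: eq_bigr => j _.
  by rewrite /v (negPf ik); case: eqP => [->|_]; rewrite ?addn0.
have : \sum_i \sum_j v i j + 2 * ones w k = \sum_i \sum_j w i j + \sum_i ones w i.
  rewrite -[RHS]big_split /= -(eq_bigr _ (fun i _ => vE i)) big_split /=.
  by rewrite -big_mkcond big_pred1_eq.
by lia.
Qed.

(** * Assembling the argument *)

Local Open Scope ring_scope.

Theorem theorem7p8 (R : realType) (d n : nat) (hd : (0 < d)%N) (hn : (0 < n)%N)
    (A : mdmatrix bool d n) (hA : extremal R A)
    (hdef : deficiency_eq A (1 : R) \/ deficiency_eq A (2^-1 : R)) :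
  diagonally_extremal R A.
Proof.
case: hA => noK ext; split=> // a Aa.
(* [e] is twice the deficiency, which treats both cases at once. *)
have [e e2 [W [inW maxW] We]] : exists2 e : nat, (0 < e <= 2)%N &
    exists2 W : R, max_polyplex_weight A W & e%:R / 2 = n%:R - W.
  case: hdef => -[W mW We]; [exists 2%N | exists 1%N] => //; exists W => //.
    by rewrite divff// pnatr_eq0.
  by rewrite mul1r.
pose del : R := e%:R / 2.
have nW : n%:R - del = W by rewrite /del We; ring.
have del_half : 2^-1 <= del.
  by rewrite -[leLHS]mul1r ler_wpM2r ?invr_ge0 ?ler0n// ler1n; case/andP: e2.
have del0 : 0 < del by apply: lt_le_trans del_half; rewrite invr_gt0 ltr0n.
have cover_ge (m : 'I_d -> 'I_n -> R) : cover A m -> n%:R - del <= \sum_i \sum_j m i j.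
  by rewrite nW => Am; apply: cover_weight_ge Am inW.
have [l Al] := strong_duality hd maxW.
rewrite -nW => lW.
have zero_le m b : cover A m -> \sum_i \sum_j m i j <= n%:R - del -> A b = false ->
    \sum_i m i (b i) <= 1 - del.
  by move=> Am mW /ext; exact: cover_zero_le.
have [z lz] := optimal_cover_row_min0 hn Al del0 lW cover_ge.
have [|w [w2 wA wl]] := half_integral_cover Al lz.
  by move=> b Ab; have := zero_le _ _ Al lW Ab; lra.
have half_cover (v : 'I_d -> 'I_n -> nat) : (forall b, A b -> (2 <= \sum_i v i (b i))%N) ->
    cover A (fun i j => (v i j)%:R / 2 : R).
  move=> vA; split=> [i j|b /vA]; first by rewrite divr_ge0 ?ler0n.
  by rewrite -mulr_suml -natr_sum ler_pdivlMr ?ltr0n// mul1r ler_nat.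
have sum_half (v : 'I_d -> 'I_n -> nat) :
    \sum_i \sum_j (v i j)%:R / 2 = (\sum_i \sum_j v i j)%:R / 2 :> R.
  rewrite natr_sum mulr_suml; apply: eq_bigr => i _.
  by rewrite natr_sum mulr_suml.
have double_ge (v : 'I_d -> 'I_n -> nat) : (forall b, A b -> (2 <= \sum_i v i (b i))%N) ->
    (2 * n <= \sum_i \sum_j v i j + e)%N.
  move=> /half_cover/cover_ge; rewrite sum_half -(ler_nat R) natrD natrM /del.
  by move=> ?; lra.
have whalf : \sum_i \sum_j (w i j)%:R / 2 <= n%:R - del :> R.
  apply: le_trans lW; apply: ler_sum => i _; apply: ler_sum => j _.
  by rewrite ler_pdivrMr ?ltr0n// mulrC.
(* Rounding down gives one inequality and [double_ge] the other, so half of [w] is again an optimal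
   cover and [cover_zero_le] applies to it. *)
have sw : (\sum_i \sum_j w i j + e = 2 * n)%N.
  apply/eqP; rewrite eqn_leq double_ge// andbT -(ler_nat R) natrD natrM.
  by move: whalf; rewrite sum_half /del => ?; lra.
apply: (del_index_contains_diagonal hn e2 w2 sw) => // [b Ab|].
  have := zero_le _ _ (half_cover _ wA) whalf Ab.
  rewrite -mulr_suml -natr_sum -(ler_nat R) natrD /del => ?; lra.
apply: (double_cover_ones w2 wA) => v /double_ge; lia.
Qed.
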